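(* For any integers $t\geq 2$, $k\geq t+1$ and $\ell\geq 6$, there exists a $t$-chromatic $P_\ell$-free graph $G$ such that the reconfiguration graph $\mathcal{R}_k(G)$ is disconnected.
   Context: All graphs are finite and simple. $P_\ell$ denotes the path on $\ell$ vertices; a graph is $P_\ell$-free if it contains no induced subgraph isomorphic to $P_\ell$. A $k$-coloring of $G$ is a proper vertex coloring $\phi:V(G)\to\{1,\dots,k\}$, i.e. $\phi(u)\neq\phi(v)$ for adjacent $u,v$ (not all colors need be used). $G$ is $t$-chromatic if its chromatic number $\chi(G)$ equals $t$. The reconfiguration graph $\mathcal{R}_k(G)$ has as vertices all $k$-colorings of $G$, two $k$-colorings being joined by an edge if they differ in color on exactly one vertex of $G$. *)

(* Defs.v *)
From mathcomp Require Import all_boot.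

Set Implicit Arguments.
Unset Strict Implicit.
Unset Printing Implicit Defensive.

Record sgraph := SGraph {
  vertex :> finType;
  adj : rel vertex;
  adj_sym : symmetric adj;
  adj_irrefl : irreflexive adj }.

Definition isomorphic (G H : sgraph) : Prop :=
  exists2 f : G -> H, bijective f & forall x y, adj (f x) (f y) = adj x y.

Section Induced.
Variables (G : sgraph) (S : {set G}).

Definition induced_adj : rel {x : G | x \in S} :=
  fun x y => adj (val x) (val y).

Lemma induced_adj_sym : symmetric induced_adj.
Proof. by move=> x y; apply: adj_sym. Qed.

Lemma induced_adj_irrefl : irreflexive induced_adj.
Proof. by move=> x; apply: adj_irrefl. Qed.

Definition induced : sgraph := SGraph induced_adj_sym induced_adj_irrefl.

End Induced.

Section PathGraph.
Variable l : nat.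

Definition path_adj : rel 'I_l :=
  fun i j => (i.+1 == j :> nat) || (j.+1 == i :> nat).

Lemma path_adj_sym : symmetric path_adj.
Proof. by move=> i j; rewrite /path_adj orbC. Qed.

Lemma path_adj_irrefl : irreflexive path_adj.
Proof. by move=> i; rewrite /path_adj orbb -[X in _ == X]addn0 -addn1 eqn_add2l. Qed.

Definition path_graph : sgraph := SGraph path_adj_sym path_adj_irrefl.

End PathGraph.

Definition path_free (l : nat) (G : sgraph) : Prop :=
  forall S : {set G}, ~ isomorphic (induced S) (path_graph l).

Definition proper (G : sgraph) (k : nat) (phi : {ffun G -> 'I_k}) : bool :=
  [forall x, forall y, adj x y ==> (phi x != phi y)].

(* The colors 1, ..., k are represented by 0, ..., k - 1. *)
Definition coloring (G : sgraph) (k : nat) : finType :=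
  {phi : {ffun G -> 'I_k} | proper phi}.

Definition colorable (G : sgraph) (k : nat) : bool := 0 < #|coloring G k|.

Lemma colorable_card (G : sgraph) : exists k, colorable G k.
Proof.
exists #|G|; apply/card_gt0P.
have pr : proper [ffun x : G => enum_rank x].
  apply/forallP => x; apply/forallP => y; apply/implyP => xy.
  rewrite !ffunE (inj_eq enum_rank_inj).
  by apply: contraTneq xy => ->; rewrite adj_irrefl.
by exists (Sub [ffun x : G => enum_rank x] pr : coloring G #|G|).
Qed.

Definition chromatic_number (G : sgraph) : nat := ex_minn (colorable_card G).

Section Reconfiguration.
Variables (G : sgraph) (k : nat).

Definition recolor : rel (coloring G k) :=
  fun phi psi => #|[set x | val phi x != val psi x]| == 1.

Lemma recolor_sym : symmetric recolor.
Proof.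
move=> phi psi; rewrite /recolor; congr (_ == _).
by apply: eq_card => x; rewrite !inE eq_sym.
Qed.

Lemma recolor_irrefl : irreflexive recolor.
Proof.
move=> phi; rewrite /recolor eq_card0 // => x.
by rewrite !inE eqxx.
Qed.

Definition reconfiguration_graph : sgraph := SGraph recolor_sym recolor_irrefl.

End Reconfiguration.

Definition connected (G : sgraph) : Prop :=
  forall x y : G, connect (@adj G) x y.

(* Main.v *)
Require Import Defs.
From mathcomp Require Import all_boot zify.

Set Implicit Arguments.
Unset Strict Implicit.
Unset Printing Implicit Defensive.

(** Remove a perfect matching from [K_{m,m}], with [m = k - (t - 2)], and join
    the result with [t - 2] further vertices forming a clique. The graph is
    [t]-chromatic; giving the two ends of each removed edge the same color and
    the clique the remaining colors yields a [k]-coloring in which every vertex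
    sees all other colors, hence an isolated vertex of the reconfiguration graph.
    On an induced [P_6] no vertex lies in the clique, as each has two
    non-neighbors; so the path alternates between the sides of [K_{m,m}], and its
    first vertex misses both the fourth and the sixth, although a vertex has only
    one non-neighbor on the opposite side. *)

(* The clique vertices are duplicated into non-adjacent twins, so that the
   vertex set is uniformly ['I_k * bool]: the matched pairs and the pairs of
   twins are the fibres of the first projection. *)
Definition matching_adj (s k : nat) : rel ('I_k * bool) :=
  fun x y => (x.1 != y.1) && [|| x.2 != y.2, x.1 < s | y.1 < s].

Lemma matching_adj_sym s k : symmetric (@matching_adj s k).
Proof.
by move=> x y; rewrite /matching_adj (eq_sym x.1) (eq_sym x.2) (orbC (x.1 < s)).
Qed.

Lemma matching_adj_irrefl s k : irreflexive (@matching_adj s k).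
Proof. by move=> x; rewrite /matching_adj eqxx. Qed.

Definition matching_graph (s k : nat) : sgraph :=
  SGraph (@matching_adj_sym s k) (@matching_adj_irrefl s k).

Section MatchingGraph.
Variables s k : nat.
Local Notation G := (matching_graph s k).

Lemma fibre_at_most_two (x y z : G) :
  x.1 = y.1 -> x.1 = z.1 -> x != y -> x != z -> y = z.
Proof. by case: x y z => [i []] [j []] [h []] /= <- <-; rewrite ?eqxx. Qed.

(** The fibre of [x] has only one further vertex, so [y] or [z] lies outside it; there,
    non-adjacency forces equal sides and indices at least [s]. *)
Lemma two_nonneighbors (x y z : G) :
  x != y -> x != z -> y != z -> ~~ adj x y -> ~~ adj x z ->
  (s <= x.1) && ((x.2 == y.2) || (x.2 == z.2)).
Proof.
move=> xy xz yz; rewrite /= /matching_adj !negb_and !negb_or !negbK -!leqNgt.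
have [exy|_] /= := eqVneq x.1 y.1; have [exz|_] /= := eqVneq x.1 z.1.
- by rewrite (fibre_at_most_two exy exz xy xz) eqxx in yz.
- by move=> _ /and3P[-> -> _]; rewrite orbT.
- by move=> /and3P[-> -> _].
- by move=> /and3P[-> -> _].
Qed.

Lemma matching_graph_path_free l : 6 <= l -> path_free l G.
Proof.
move=> hl S [f [g fK gK] fadj].
(* Six consecutive vertices of the path suffice, whatever [l] is. *)
pose p n (h : n < 6) : G := val (g (Ordinal (leq_trans h hl))).
have adjp m n (hm : m < 6) (hn : n < 6) :
  adj (p m hm) (p n hn) = (m.+1 == n) || (n.+1 == m).
  rewrite [LHS](_ : _ = @adj (induced S) (g (Ordinal (leq_trans hm hl)))
                                    (g (Ordinal (leq_trans hn hl)))) //.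
  by rewrite -fadj !gK.
have neqp m n (hm : m < 6) (hn : n < 6) : (p m hm != p n hn) = (m != n).
  by rewrite (inj_eq val_inj) (inj_eq (can_inj gK)).
have far a b c (ha : a < 6) (hb : b < 6) (hc : c < 6) :
    [&& a != b, a != c, b != c, ~~ ((a.+1 == b) || (b.+1 == a))
      & ~~ ((a.+1 == c) || (c.+1 == a))] ->
    (s <= (p a ha).1) &&
      (((p a ha).2 == (p b hb).2) || ((p a ha).2 == (p c hc).2)).
  by case/and5P=> *; apply: two_nonneighbors; rewrite ?adjp ?neqp.
have big n (h : n < 6) : s <= (p n h).1.
  case: n h => [|[|[|[|[|[|//]]]]]] h;
    [ have := @far 0 2 3 h isT isT isT | have := @far 1 3 4 h isT isT isT
    | have := @far 2 4 5 h isT isT isT | have := @far 3 0 1 h isT isT isT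
    | have := @far 4 0 1 h isT isT isT | have := @far 5 0 1 h isT isT isT ];
    by case/andP.
have side n (h : n < 6) (h' : n.+1 < 6) : (p n h).2 = ~~ (p n.+1 h').2.
  have : adj (p n h) (p n.+1 h') by rewrite adjp eqxx.
  rewrite /= /matching_adj !ltnNge !big !orbF => /andP[_].
  by case: ((p n h).2) => /=; case: ((p n.+1 h').2).
have /andP[_] := @far 0 3 5 isT isT isT isT.
rewrite (@side 0 isT isT) (@side 1 isT isT) (@side 2 isT isT).
by rewrite (@side 3 isT isT) (@side 4 isT isT); case: (p 5 isT).2.
Qed.

Lemma matching_graph_chromatic_number : s + 2 <= k -> chromatic_number G = s + 2.
Proof.
move=> hk; rewrite /chromatic_number; case: ex_minnP => m colm minm.
apply/eqP; rewrite eqn_leq; apply/andP; split.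
  apply: minm; apply/card_gt0P.
  (* Twins share their index as color; the two sides of the bipartite part get [s] and [s + 1]. *)
  have lt_col (x : G) : (if x.1 < s then x.1 : nat else s + x.2) < s + 2.
    by case: (ltnP x.1 s); case: x.2; lia.
  pose phi := [ffun x : G => Ordinal (lt_col x)].
  suff pr : Defs.proper phi by exists (Sub phi pr : coloring G (s + 2)).
  apply/forallP => x; apply/forallP => y; apply/implyP.
  rewrite !ffunE -val_eqE /= /matching_adj -val_eqE /=.
  by case: x y => [x []] [y []] /=; do 2 case: ltnP => ?; lia.
have [[phi pr] _] := card_gt0P colm.
(* A clique of size [s + 2]: only the indices [s] and [s + 1] are both outside the range below [s],
   so these two must lie on opposite sides. *)
pose q (j : 'I_(s + 2)) : G := (widen_ord hk j, j == s.+1 :> nat).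
have inj : injective (phi \o q).
  move=> i j /= e; apply/eqP; apply/negPn/negP => ij.
  have /negP[] : phi (q i) != phi (q j); last by rewrite e.
  have /forallP/(_ (q i))/forallP/(_ (q j))/implyP := pr; apply.
  rewrite /= /matching_adj -val_eqE /=; move: ij; rewrite -val_eqE /=.
  have := ltn_ord i; have := ltn_ord j.
  by case: eqP => ?; case: eqP => ?; lia.
by have := leq_card _ inj; rewrite !card_ord.
Qed.

Lemma proper_index (f : 'I_k -> 'I_k) :
  injective f -> Defs.proper [ffun x : G => f x.1].
Proof.
move=> injf; apply/forallP => x; apply/forallP => y; apply/implyP.
by rewrite !ffunE (inj_eq injf) => /andP[].
Qed.

Definition index_coloring (f : 'I_k -> 'I_k) (injf : injective f) :
  coloring G k := Sub [ffun x : G => f x.1] (proper_index injf).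

Lemma index_coloring_frozen (chi : coloring G k) :
  ~~ recolor (index_coloring (@inj_id 'I_k)) chi.
Proof.
apply/negP => /cards1P[x D].
have inD y : (y.1 != val chi y) = (y == x).
  by have /setP/(_ y) := D; rewrite !inE /= ffunE.
(* This neighbor of [x] already has the new color of [x], and keeps it because only [x] is
   recolored. *)
pose y : G := (val chi x, ~~ x.2).
have cx : x.1 != val chi x by rewrite inD.
have yx : y != x by apply: contraNneq cx => /(congr1 fst) <-.
have xy : adj x y by rewrite /= /matching_adj cx /=; case: x.2.
have /forallP/(_ x)/forallP/(_ y)/implyP/(_ xy) := valP chi.
by rewrite -[val chi x]/y.1 inD (negPf yx).
Qed.

Lemma matching_graph_disconnected :
  2 <= k -> ~ connected (reconfiguration_graph G k).
Proof.
move=> hk conn.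
have /connectP[[|chi c] /=] :=
  conn (index_coloring (@inj_id 'I_k)) (index_coloring (@rev_ord_inj k)).
  (* The empty path would equate the two colorings, but reversal sends index [0] to [k - 1], which
     is positive. *)
  move=> _ /(congr1 val)/ffunP/(_ (Ordinal (ltnW hk), true)).
  by rewrite !ffunE => /(congr1 val) /=; lia.
by rewrite (negPf (index_coloring_frozen chi)).
Qed.

End MatchingGraph.

Theorem proposition1p2 (t k l : nat) (ht : 2 <= t) (hk : t + 1 <= k) (hl : 6 <= l) :
  exists G : sgraph,
    [/\ chromatic_number G = t,
        path_free l G &
        ~ connected (reconfiguration_graph G k)].
Proof.
exists (matching_graph (t - 2) k); split.
- by rewrite matching_graph_chromatic_number; lia.
- exact: matching_graph_path_free.
- by apply: matching_graph_disconnected; lia.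
Qed.
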